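(* Let $(X,T)$ be a topological dynamical system with compatible metric $d$ on $X$, and let $K$ be a non-empty compact subset of $X$. Then $$\overline{mdim}_{FK}^P(T,K,d)=\limsup_{\epsilon\to 0}\frac{\sup\{\overline{h}_{\mu}^{FK}(T,\epsilon):\mu\in M(X),\ \mu(K)=1\}}{\log\frac{1}{\epsilon}}.$$
   Context: A topological dynamical system $(X,T)$ is a compact metric space $X$ with metric $d$ together with a continuous map $T:X\to X$. $M(X)$ is the set of all Borel probability measures on $X$. **Feldman–Katok metric.** For $x,y\in X$, $\delta>0$, $n\in\mathbb{N}$ (positive integer), an $(n,\delta)$-match of $x$ and $y$ is an order preserving bijection $\pi:D(\pi)\to R(\pi)$ (i.e. $\pi(i)<\pi(j)$ whenever $i<j$) with $D(\pi),R(\pi)\subset\{0,1,\dots,n-1\}$ such that $d(T^ix,T^{\pi(i)}y)<\delta$ for every $i\in D(\pi)$. Let $|\pi|$ be the cardinality of $D(\pi)$, and put $$\bar f_{n,\delta}(x,y)=1-\frac{\max\{|\pi|:\pi\text{ is an }(n,\delta)\text{-match of }x\text{ and }y\}}{n},\qquad d_{FK_n}(x,y)=\inf\{\delta>0:\bar f_{n,\delta}(x,y)<\delta\}.$$ For $\epsilon>0$ let $B_{FK_n}(x,\epsilon)=\{y\in X:d_{FK_n}(x,y)<\epsilon\}$ and $\overline{B}_{FK_n}(x,\epsilon)=\{y\in X:d_{FK_n}(x,y)\le\epsilon\}$. **FK-Packing metric mean dimension.** For $Z\subset X$, $\epsilon>0$, $N\in\mathbb{N}$, $s\in\mathbb{R}$,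 let $$P_{FK}(T,d,Z,s,N,\epsilon)=\sup\Big\{\sum_{i\in I}e^{-n_is}\Big\},$$ the supremum over all finite or countable pairwise disjoint families $\{\overline{B}_{FK_{n_i}}(x_i,\epsilon)\}_{i\in I}$ with $x_i\in Z$ and $n_i\ge N$. This is non-increasing in $N$; set $P_{FK}(T,d,Z,s,\epsilon)=\lim_{N\to\infty}P_{FK}(T,d,Z,s,N,\epsilon)$ and $$\mathcal{P}_{FK}(T,d,Z,s,\epsilon)=\inf\Big\{\sum_{i=1}^{\infty}P_{FK}(T,d,Z_i,s,\epsilon):\bigcup_{i\ge1}Z_i\supseteq Z\Big\}.$$ As $s$ varies this jumps from $\infty$ to $0$ at a critical value $$\mathcal{P}_{FK}(T,d,Z,\epsilon)=\inf\{s:\mathcal{P}_{FK}(T,d,Z,s,\epsilon)=0\}=\sup\{s:\mathcal{P}_{FK}(T,d,Z,s,\epsilon)=+\infty\}.$$ Define $$\overline{mdim}_{FK}^P(T,Z,d)=\limsup_{\epsilon\to0}\frac{\mathcal{P}_{FK}(T,d,Z,\epsilon)}{\log\frac1\epsilon}.$$ **Upper local entropy.** For $\mu\in M(X)$ and $\epsilon>0$, $$\overline{h}_{\mu}^{FK}(T,x,\epsilon)=\limsup_{n\to\infty}-\frac{\log\mu(B_{FK_n}(x,\epsilon))}{n},\qquad \overline{h}_{\mu}^{FK}(T,\epsilon)=\int\overline{h}_{\mu}^{FK}(T,x,\epsilon)\,d\mu(x).$$ *)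

(* Defs.v *)
From HB Require Import structures.
From mathcomp Require Import all_boot all_order all_algebra.
From mathcomp Require Import all_classical all_reals all_analysis.

Set Implicit Arguments.
Unset Strict Implicit.
Unset Printing Implicit Defensive.

Import Order.TTheory GRing.Theory Num.Theory.
Import numFieldNormedType.Exports.

Local Open Scope classical_set_scope.
Local Open Scope ring_scope.

(* MathComp-Analysis only builds measurable types on pointed carriers. A base
   point says no more than that the space is nonempty, and none of the
   definitions below refers to it. *)
#[short(type="pointedMetricType")]
HB.structure Definition PointedMetric (K : numDomainType) :=
  { M of Metric K M & isPointed M }.

Notation borel X := (g_sigma_algebraType (@open X)).

Section FeldmanKatok.
Context {R : realType} {X : pointedMetricType R}.
Variable T : X -> X.

Implicit Types (x y : X) (n N : nat) (Z : set X) (s eps delta : R).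

(* The pair (D, pi) encodes the order preserving bijection pi : D -> pi @: D
   between subsets of {0, .., n - 1}; the values of pi outside D are junk. *)
Definition fk_match n delta x y (D : {set 'I_n}) (pi : {ffun 'I_n -> 'I_n}) :
    bool :=
  [forall i in D, forall j in D, (i < j)%N ==> (pi i < pi j)%N] &&
  [forall i in D, mdist (iter i T x) (iter (pi i) T y) < delta].

Definition fbar n delta x y : R :=
  1 - (\max_(p : {set 'I_n} * {ffun 'I_n -> 'I_n}
             | fk_match delta x y p.1 p.2) #|p.1|)%:R / n%:R.

Definition dFK n x y : R :=
  inf [set delta | 0 < delta /\ fbar n delta x y < delta].

Definition FKball n x eps : set X := [set y | dFK n x y < eps].

Definition FKcball n x eps : set X := [set y | dFK n x y <= eps].

Local Open Scope ereal_scope.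

(* The families are indexed by arbitrary sets I of naturals, that is, they are
   the finite or countable ones. *)
Definition FKpackN Z s N eps : \bar R :=
  ereal_sup [set S | exists (I : set nat) (x : nat -> X) (n : nat -> nat),
    [/\ forall i, I i -> Z (x i),
        forall i, I i -> (N <= n i)%N,
        trivIset I (fun i => FKcball (n i) (x i) eps) &
        S = \esum_(i in I) (expR (- (n i)%:R * s))%:E]].

Definition FKpack0 Z s eps : \bar R := limn (fun N => FKpackN Z s N eps).

Definition FKpack Z s eps : \bar R :=
  ereal_inf [set \sum_(0 <= i <oo) FKpack0 (A i) s eps |
    A in [set A : nat -> set X | Z `<=` \bigcup_i A i]].

Definition FKpack_crit Z eps : \bar R :=
  ereal_inf [set s%:E | s in [set s : R | FKpack Z s eps = 0]].

Definition mdimFKP Z : \bar R :=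
  limf_esup (fun eps : R => FKpack_crit Z eps / (ln (1 / eps))%:E) 0^'+.

Definition local_entropyFK (mu : probability (borel X) R) x eps : \bar R :=
  limn_esup (fun n => - lne (mu (FKball n x eps)) / n%:R%:E).

Definition entropyFK (mu : probability (borel X) R) eps : \bar R :=
  \int[mu]_x local_entropyFK mu x eps.

End FeldmanKatok.

(* Main.v *)
Require Import Defs.
From HB Require Import structures.
From mathcomp Require Import all_boot all_order all_algebra.
From mathcomp Require Import all_classical all_reals all_analysis.
From mathcomp Require Import finmap measurable_realfun ring lra.

Set Implicit Arguments.
Unset Strict Implicit.
Unset Printing Implicit Defensive.

Import Order.TTheory GRing.Theory Num.Theory.
Import numFieldNormedType.Exports.

Local Open Scope classical_set_scope.
Local Open Scope ring_scope.

(** The two functions of [eps] whose growth is compared already agree up to a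
    rescaling of [eps]: writing [P eps] for the critical packing value of [K]
    and [H eps] for the supremum of the entropies at scale [eps] over the
    probability measures carried by [K], we have
      [P eps <= H eps <= P (eps / 3)],
    and replacing [eps] by [eps / 3] changes [ln (1 / eps)] by the constant
    [ln 3], which is lost in the upper limit ([limf_esup_div_ln]).

    Both inequalities go through a notion of small set: a countable union of
    sets on which the packing sums at exponent [s] are eventually finite. The
    critical value is the infimum of the [s] at which [K] is small
    ([FKpack_eq0_small], [small_FKpack_eq0]), and small sets form a
    sigma-ideal, which makes them easier to handle than the packing outer
    measure itself.

    Upper bound ([entropyFK_le]). Let [K] be small at exponent [s] and scale
    [eps / 3]. Points whose ball of order [n] and radius [eps] has mass at most
    [exp (- n s')], with [s < s'], contain a maximal family with disjoint closed
    balls of radius [eps / 3]; the finiteness of the packing sums bounds its size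
    by [C exp (n s)], and maximality makes the [eps]-balls around it a cover. So
    those points have mass at most [C exp (- n (s' - s))], which is summable, and
    by the Borel-Cantelli lemma the local entropy is at most [s'] almost
    everywhere on the piece considered.

    Lower bound ([exists_entropy_ge]). Let [K] not be small at exponent [s].
    Removing from [K] all basic open sets in which it is small leaves a set [Z]
    every nonempty relatively open part of which is not small ([small_core]), so
    that arbitrarily late packings of large total weight exist near each point of
    [Z]. These are used to grow a tree of pairs (point, time): a node [(x, m)]
    owns a subinterval of [0, 1[ of length at most [exp (- m s)], and is refined
    by splitting its interval among the elements of a packing very close to [x].
    The nodes containing a given [t] converge to a point [f t] of [K], and the
    image of Lebesgue measure under [f] is the measure sought, provided that the
    ball of order [m] and radius [eps] around a point descending from [(x, m)]
    meets no descendant of another node of the same stage.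

    For the Bowen metrics this separation is inherited by the children because
    those metrics increase with [n]. The Feldman-Katok metrics do not, and this
    is the one point where the classical construction must be changed. Nodes are
    refined one at a time, and the packing that replaces a node is required to
    have no ball containing the point of another node. This costs almost nothing:
    the balls of a packing are disjoint, so each point to be avoided excludes at
    most one of them ([packing_avoid]). *)

(** * The Feldman-Katok pseudometrics *)

Section FKmetric.
Context {R : realType} {X : pointedMetricType R}.
Variable T : X -> X.
Implicit Types (x y z : X) (n : nat) (d e : R).

(** A match given by its graph: an increasing chain of pairs. Unlike a pair
    (domain, function), this form is symmetric and easy to compose. *)
Definition matching n d x y (M : {set 'I_n * 'I_n}) :=
  (forall p q, p \in M -> q \in M -> (p.1 < q.1)%N = (p.2 < q.2)%N) /\
  (forall p, p \in M -> mdist (iter p.1 T x) (iter p.2 T y) < d).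

Lemma ord_neq_ltn n (i j : 'I_n) : (i == j) = ~~ (i < j)%N && ~~ (j < i)%N.
Proof. by rewrite -!leqNgt -eqn_leq eq_sym. Qed.

Lemma matching_inj n d x y (M : {set 'I_n * 'I_n}) : matching d x y M ->
  forall p q, p \in M -> q \in M -> (p.1 == q.1) = (p.2 == q.2).
Proof. by move=> [Mlt _] p q pM qM; rewrite !ord_neq_ltn !Mlt. Qed.

Lemma matching_fst_inj n d x y (M : {set 'I_n * 'I_n}) : matching d x y M ->
  {in M &, injective fst}.
Proof.
move=> Mm [a b] [a' b'] pM qM /= aa'; move: (matching_inj Mm pM qM) => /=.
by rewrite aa' eqxx => /esym/eqP ->.
Qed.

Lemma matching_snd_inj n d x y (M : {set 'I_n * 'I_n}) : matching d x y M ->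
  {in M &, injective snd}.
Proof.
move=> Mm [a b] [a' b'] pM qM /= aa'; move: (matching_inj Mm pM qM) => /=.
by rewrite aa' eqxx => /eqP ->.
Qed.

(** Passes from the maximal match in the definition of [fbar] to a witness; all
    later facts about [dFK] are obtained by manipulating witnesses. *)
Lemma fbar_ltP n d x y e : fbar T n d x y < e <->
  exists2 M : {set 'I_n * 'I_n}, matching d x y M & 1 - #|M|%:R / n%:R < e.
Proof.
rewrite /fbar; split.
  have P0 : (0 < #|fun p : {set 'I_n} * {ffun 'I_n -> 'I_n} =>
                 fk_match T d x y p.1 p.2|)%N.
    apply/card_gt0P; exists (finset.set0, [ffun i => i]).
    rewrite unfold_in /fk_match; apply/andP; split.
      by apply/'forall_implyP => i; rewrite inE.
    by apply/'forall_implyP => i; rewrite inE.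
  have [[D pi] /= + ->] := eq_bigmax_cond
    (fun p : {set 'I_n} * {ffun 'I_n -> 'I_n} => #|p.1|) P0.
  rewrite unfold_in /= => /andP[/forallP/= incr /forallP/= close] lte.
  exists [set (i, pi i) | i in D]%SET.
    split.
      have mono i j : i \in D -> j \in D -> (i < j)%N -> (pi i < pi j)%N.
        move=> iD jD ij; move: (incr i); rewrite iD /= => /forallP/(_ j).
        by rewrite jD ij.
      move=> _ _ /imsetP[i iD ->] /imsetP[j jD ->] /=.
      have [ij|ji|/val_inj ->] := ltngtP i j; last by rewrite ltnn.
        by rewrite mono.
      by apply/esym/negbTE; rewrite -leqNgt ltnW// mono.
    by move=> _ /imsetP[i iD ->] /=; move: (close i); rewrite iD.
  by rewrite card_imset// => i j [].
move=> [M Mm]; apply: le_lt_trans.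
pose D : {set 'I_n} := [set p.1 | p in M]%SET.
pose pi := [ffun i : 'I_n => odflt i (omap snd [pick p in M | p.1 == i])].
have piE p : p \in M -> pi p.1 = p.2.
  move=> pM; rewrite ffunE; case: pickP => [q /andP[qM /eqP qp]|/(_ p)] /=.
    by rewrite (matching_fst_inj Mm qM pM).
  by rewrite pM eqxx.
have DM : #|D| = #|M| by rewrite card_in_imset//; exact: matching_fst_inj Mm.
rewrite lerB// ler_wpM2r ?invr_ge0// ler_nat -DM.
apply: (@leq_bigmax_cond _ _
  (fun p : {set 'I_n} * {ffun 'I_n -> 'I_n} => #|p.1|) (D, pi)) => /=.
case: (Mm) => Mlt Mclose; apply/andP; split.
  apply/forallP => i; apply/implyP => /imsetP[p pM ->].
  apply/forallP => j; apply/implyP => /imsetP[q qM ->].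
  by apply/implyP => pq; rewrite !piE// -Mlt.
by apply/forallP => i; apply/implyP => /imsetP[p pM ->]; rewrite piE// Mclose.
Qed.

Lemma fbar_le1 n d x y : fbar T n d x y <= 1.
Proof. by rewrite /fbar lerBlDr lerDl divr_ge0. Qed.

Let dset n x y := [set d | 0 < d /\ fbar T n d x y < d].

Let dset_lb n x y : has_inf (dset n x y).
Proof.
split; last by exists 0 => d [/ltW].
by exists 2; split => //; rewrite (le_lt_trans (fbar_le1 _ _ _ _))// ltr1n.
Qed.

Lemma dFK_ge0 n x y : 0 <= dFK T n x y.
Proof. by apply: lb_le_inf; [case: (dset_lb n x y)|move=> d [/ltW]]. Qed.

Lemma dFK_ltP n x y e : dFK T n x y < e <->
  exists d, [/\ 0 < d, d < e & exists2 M : {set 'I_n * 'I_n},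
    matching d x y M & 1 - #|M|%:R / n%:R < d].
Proof.
split.
  move=> lte; have /(inf_adherent)/(_ (dset_lb n x y)) : 0 < e - dFK T n x y.
    by rewrite subr_gt0.
  move=> [d [d0 /fbar_ltP fd]]; rewrite -/(dset n x y) -/(dFK T n x y) => de.
  by exists d; split => //; rewrite (lt_le_trans de)// addrC subrK.
move=> [d [d0 de /fbar_ltP fd]]; apply: le_lt_trans de.
by apply: ge_inf; [case: (dset_lb n x y)|split].
Qed.

(** At order [0] the quotient [_ / 0] is [0], so that [dFK T 0] is constant
    (and equal to [1]): in particular it does not vanish on the diagonal. *)
Lemma dFK0E x y x' y' : dFK T 0 x y = dFK T 0 x' y'.
Proof.
have u0 (u : R) : u / 0%:R = 0 by rewrite invr0 mulr0.
by rewrite /dFK /fbar; congr inf; apply/funext => d /=; rewrite !u0.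
Qed.

Lemma dFK_sym_le n x y : dFK T n y x <= dFK T n x y.
Proof.
apply/ler_addgt0Pl => e e0; apply/ltW/dFK_ltP.
have /dFK_ltP[d [d0 de [M [Mlt Mclose] Mc]]] : dFK T n x y < e + dFK T n x y.
  by rewrite ltrDr.
exists d; split => //; exists [set (p.2, p.1) | p in M]%SET.
  split.
    by move=> _ _ /imsetP[p pM ->] /imsetP[q qM ->] /=; rewrite Mlt.
  by move=> _ /imsetP[p pM ->] /=; rewrite metric_sym Mclose.
by rewrite card_imset// => -[a b] [a' b'] [-> ->].
Qed.

Lemma dFK_sym n x y : dFK T n x y = dFK T n y x.
Proof. by apply/eqP; rewrite eq_le !dFK_sym_le. Qed.

(** Two chains in ['I_n * 'I_n] are composed over the common part of the second
    projection of [M1] and the first projection of [M2]; these are subsets of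
    ['I_n], hence they share at least [#|M1| + #|M2| - n] elements. *)
Lemma matching_comp n d1 d2 x y z (M1 M2 : {set 'I_n * 'I_n}) :
  matching d1 x y M1 -> matching d2 y z M2 ->
  exists2 M : {set 'I_n * 'I_n}, matching (d1 + d2) x z M &
    (#|M1| + #|M2| <= n + #|M|)%N.
Proof.
move=> m1 m2.
(* the pairs of [M1] that [M2] continues; [g] is the continuation *)
pose N : {set 'I_n * 'I_n} :=
  finset (fun p => (p \in M1) && (p.2 \in imset fst (mem M2))).
pose g (j : 'I_n) := odflt j (omap snd [pick q in M2 | q.1 == j]).
have gP p : p \in N -> (p.2, g p.2) \in M2.
  rewrite inE => /andP[pM1 /imsetP[q qM2 pq]]; rewrite /g.
  case: pickP => [q' /andP[q'M /eqP q'p]|/(_ q)] /=.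
    by rewrite -q'p -surjective_pairing.
  by rewrite qM2 pq eqxx.
have NM p : p \in N -> p \in M1 by rewrite inE => /andP[].
exists [set (p.1, g p.2) | p in N]%SET.
  case: m1 m2 => lt1 cl1 [lt2 cl2]; split.
    move=> _ _ /imsetP[p pN ->] /imsetP[q qN ->] /=.
    by rewrite lt1 ?NM// (lt2 _ _ (gP _ pN) (gP _ qN)).
  move=> _ /imsetP[p pN ->] /=.
  apply: le_lt_trans (metric_triangle _ (iter p.2 T y) _) _.
  by rewrite ltrD// ?cl1 ?NM// (cl2 _ (gP _ pN)).
rewrite card_in_imset; last first.
  by move=> p q pN qN [pq _]; apply: (matching_fst_inj m1); rewrite ?NM.
have -> : #|N| = #|imset snd (mem M1) :&: imset fst (mem M2)|%SET.
  rewrite -(card_in_imset (f := snd) (D := N)); last first.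
    by move=> p q pN qN; apply: (matching_snd_inj m1); rewrite NM.
  apply: eq_card => j; rewrite inE; apply/imsetP/andP.
    by move=> [p]; rewrite inE => /andP[pM1 pM2] ->; split => //; exact: imset_f.
  move=> [/imsetP[p pM1 ->] pM2]; exists p => //.
  by rewrite inE pM1.
rewrite -(card_in_imset (matching_snd_inj m1)).
rewrite -(card_in_imset (matching_fst_inj m2)) -cardsUI leq_add2r.
by rewrite -[leqRHS]card_ord max_card.
Qed.

Lemma dFK_triangle n x y z : dFK T n x z <= dFK T n x y + dFK T n y z.
Proof.
apply/ler_addgt0Pr => e e0; apply/ltW/dFK_ltP.
have e20 : 0 < e / 2 by rewrite divr_gt0.
have /dFK_ltP[d [d0 de [M m Mc]]] : dFK T n x y < dFK T n x y + e / 2.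
  by rewrite ltrDl.
have /dFK_ltP[d' [d'0 d'e [M' m' Mc']]] : dFK T n y z < dFK T n y z + e / 2.
  by rewrite ltrDl.
exists (d + d'); split; [exact: addr_gt0|lra|].
have [M'' m'' c''] := matching_comp m m'; exists M'' => //.
have [n0|n0] := posnP n.
  have nV : n%:R^-1 = 0 :> R by rewrite n0 invr0.
  by move: Mc Mc'; rewrite nV !mulr0; lra.
have : (#|M| + #|M'|)%:R / n%:R <= (n + #|M''|)%:R / n%:R :> R.
  by rewrite ler_wpM2r ?invr_ge0// ler_nat.
by rewrite !natrD !mulrDl divff ?pnatr_eq0 -?lt0n//; lra.
Qed.

(** The identity match compares [dFK] with the Bowen metric. Together with the
    triangle inequality this yields every continuity property used below. *)
Lemma dFK_Bowen n x y d : (0 < n)%N -> 0 < d ->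
  (forall i, (i < n)%N -> mdist (iter i T x) (iter i T y) < d) ->
  dFK T n x y <= d.
Proof.
move=> n0 d0 xy; apply/ler_addgt0Pr => e e0; apply/ltW/dFK_ltP.
exists d; split; rewrite ?ltrDl//; exists [set (i, i) | i in finset.setT]%SET.
  split.
    by move=> _ _ /imsetP[p _ ->] /imsetP[q _ ->].
  by move=> _ /imsetP[p _ ->]; exact: xy.
rewrite card_imset; last by move=> i j [].
by rewrite cardsT card_ord divff ?subrr// pnatr_eq0 -lt0n.
Qed.

Lemma dFKxx n x : (0 < n)%N -> dFK T n x x = 0.
Proof.
move=> n0; apply/eqP; rewrite eq_le dFK_ge0 andbT.
apply/ler_addgt0Pr => e e0; rewrite add0r dFK_Bowen// => i _.
by rewrite mdistxx.
Qed.

Hypothesis contT : continuous T.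

Lemma continuous_iter n : continuous (iter n T).
Proof.
elim: n => [|n IH] x; first exact: cvg_id.
exact: (@continuous_comp _ _ _ (iter n T) T x (IH x) (@contT _)).
Qed.

Lemma near_dFK n x d : (0 < n)%N -> 0 < d -> \forall y \near x, dFK T n x y <= d.
Proof.
move=> n0 d0.
suff : \forall y \near x, forall i, (i < n)%N ->
    mdist (iter i T x) (iter i T y) < d.
  by apply: filterS => y xy; exact: dFK_Bowen.
elim: n {n0} => [|n IH]; first by near=> y.
have : \forall y \near x, mdist (iter n T x) (iter n T y) < d.
  have := @continuous_iter n x _ (nbhsx_ballx (iter n T x) d d0).
  by rewrite /nbhs/= ballEmdist.
move: IH; apply: filterS2 => y IH ny i.
by rewrite ltnS leq_eqVlt => /predU1P[->//|]; exact: IH.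
Unshelve. all: by end_near. Qed.

Lemma open_FKball n x e : open (FKball T n x e).
Proof.
rewrite openE => y /= xye; rewrite /interior /FKball /= in xye *.
have [n0|n0] := posnP n.
  by apply: nearW => y'; rewrite /= {n}n0 (dFK0E x y' x y) in xye *.
have /(near_dFK y n0) : 0 < (e - dFK T n x y) / 2 by rewrite divr_gt0// subr_gt0.
apply: filterS => y' yy' /=.
have := dFK_triangle n x y y'; lra.
Qed.

(** Both endpoints move: the tree construction perturbs the centre of a ball as
    well as the points that the ball must avoid. *)
Lemma dFK_gt_near n x y e : e < dFK T n x y ->
  exists2 r, 0 < r & forall x' y', mdist x x' < r -> mdist y y' < r ->
    e < dFK T n x' y'.
Proof.
move=> exy; have [n0|n0] := posnP n.
  by exists 1 => // x' y' _ _; rewrite {n}n0 in exy *; rewrite (dFK0E x' y' x y).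
have d0 : 0 < (dFK T n x y - e) / 3 by rewrite divr_gt0// subr_gt0.
have /nbhs_ballP[r /= r0 xr] := near_dFK x n0 d0.
have /nbhs_ballP[r' /= r'0 yr'] := near_dFK y n0 d0.
exists (Num.min r r'); first by rewrite lt_min r0.
move=> x' y'; rewrite !lt_min => /andP[xx' _] /andP[_ yy'].
have := xr x'; rewrite ballEmdist => /(_ xx') /= {}xx'.
have := yr' y'; rewrite ballEmdist => /(_ yy') /= {}yy'.
have := dFK_triangle n x x' y; have := dFK_triangle n x' y' y.
rewrite (dFK_sym n y' y); lra.
Qed.

End FKmetric.

(** * Packings and small sets *)

Section Packing.
Context {R : realType} {X : pointedMetricType R}.
Variable T : X -> X.
Implicit Types (x y z : X) (Z A : set X) (n N : nat) (s eps : R).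
Implicit Types L : seq (X * nat).

(** Finite packings as duplicate-free sequences of pairs (centre, order). *)
Definition packing Z N eps L :=
  [/\ uniq L, forall p, p \in L -> Z p.1 /\ (N <= p.2)%N &
      forall p q, p \in L -> q \in L -> p != q ->
        FKcball T p.2 p.1 eps `&` FKcball T q.2 q.1 eps = set0].

Definition weight s L : R := \sum_(p <- L) expR (- p.2%:R * s).

Lemma FKcball_center n x eps : (0 < n)%N -> 0 <= eps -> FKcball T n x eps x.
Proof. by move=> n0 e0; rewrite /FKcball/= dFKxx. Qed.

Lemma FKpackN_ge Z s N eps L : packing Z N eps L ->
  ((weight s L)%:E <= FKpackN T Z s N eps)%E.
Proof.
move=> [uL ZL dL]; apply: ereal_sup_ubound.
pose nt i := nth (point, 0%N) L i.
exists `I_(size L), (fun i => (nt i).1), (fun i => (nt i).2); split.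
- by move=> i iL; have [] := ZL _ (mem_nth (point, 0%N) iL).
- by move=> i iL; have [] := ZL _ (mem_nth (point, 0%N) iL).
- apply/trivIsetP => i j iL jL ij; apply: dL; rewrite ?mem_nth//.
  by rewrite nth_uniq.
rewrite esum_fset//=.
rewrite -(fsbig_ord _ _ (fun i => (expR (- (nt i).2%:R * s))%:E)).
rewrite -sumEFin (big_nth (point, 0%N)) big_mkord.
by apply: eq_bigr.
Qed.

(** Finite packings suffice to bound [FKpackN] because an infinite sum of
    nonnegative terms is the supremum of its finite subsums. The condition
    [0 < N] makes each ball contain its centre, so that disjoint balls come from
    distinct pairs. *)
Lemma FKpackN_le Z s N eps (C : R) : (0 < N)%N -> 0 <= eps ->
  (forall L, packing Z N eps L -> weight s L <= C) ->
  (FKpackN T Z s N eps <= C%:E)%E.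
Proof.
move=> N0 e0 LC; apply: ge_ereal_sup => _ [I [x [n [xZ nN /trivIsetP dI ->]]]].
apply: ge_ereal_sup => _ [F [finF FI] <-].
have FsetI i : i \in fset_set F -> I i by rewrite in_fset_set// => /set_mem/FI.
have inj : {in fset_set F &, injective (fun i => (x i, n i))}.
  move=> i j /FsetI Ii /FsetI Ij [xij nij].
  apply/eqP/negP => /negP ij; have := dI _ _ Ii Ij ij.
  rewrite -xij -nij setIid => B0.
  have := @FKcball_center (n i) (x i) eps; rewrite B0; apply => //.
  exact: leq_trans (nN _ Ii).
rewrite fsbig_finite//= sumEFin lee_fin.
have -> : \sum_(i <- fset_set F) expR (- (n i)%:R * s) =
    weight s [seq (x i, n i) | i <- fset_set F].
  by rewrite /weight big_map.
apply: LC; split.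
- by rewrite map_inj_in_uniq// fset_uniq.
- move=> _ /mapP[i /FsetI Ii ->] /=.
  by split; [exact: xZ|exact: nN].
- move=> _ _ /mapP[i /FsetI Ii ->] /mapP[j /FsetI Ij ->] /= ij; apply: dI => //.
  by apply: contraNneq ij => ->.
Qed.

Lemma FKpackN_ge0 Z s N eps : (0 <= FKpackN T Z s N eps)%E.
Proof.
have := @FKpackN_ge Z s N eps [::]; rewrite /weight big_nil; apply.
by split.
Qed.

Lemma packingW Z A M N eps L : Z `<=` A -> (N <= M)%N -> packing Z M eps L ->
  packing A N eps L.
Proof.
move=> ZA NM [uL ZL dL]; split => // p /ZL[/ZA Ap Mp].
by split => //; exact: leq_trans Mp.
Qed.

Lemma le_FKpackN Z s eps : nonincreasing_seq (fun N => FKpackN T Z s N eps).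
Proof.
move=> N M NM; apply: ereal_sup_le => _ [I [x [n [xZ nN dI ->]]]].
by exists I, x, n; split => // i Ii; exact: leq_trans (nN _ Ii).
Qed.

(** With the order of the packings fixed at some [N] for each piece, smallness
    can be tested on finite packings, without limits or infinite sums. *)
Definition small s eps A := exists2 Z : nat -> set X, A `<=` \bigcup_i Z i &
  forall i, exists N, (FKpackN T (Z i) s N eps < +oo)%E.

Lemma FKpack0_ge0 Z s eps : (0 <= FKpack0 T Z s eps)%E.
Proof.
apply: lime_ge; first exact: (ereal_nonincreasing_is_cvgn (@le_FKpackN Z s eps)).
by apply: nearW => N; exact: FKpackN_ge0.
Qed.

Lemma FKpack_eq0_small Z s eps : FKpack T Z s eps = 0%E -> small s eps Z.
Proof.
move=> Z0; have : (FKpack T Z s eps < 1)%E by rewrite Z0 lte01.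
move=> /ereal_inf_lt[_ [A ZA <-] sum1]; exists A => // i.
apply: contrapT => /forallNP AN.
have A0 : FKpack0 T (A i) s eps = +oo%E.
  rewrite /FKpack0 (_ : (fun N => _) = fun=> +oo%E) ?lim_cst//.
  by apply/funext => N; apply/eqP; rewrite -leye_eq leNgt; apply/negP/AN.
move: sum1; rewrite (nneseries_pinfty _ _ A0)//.
by move=> *; exact: FKpack0_ge0.
Qed.

Lemma weight_le s s' N L : s <= s' -> (forall p, p \in L -> (N <= p.2)%N) ->
  weight s' L <= expR (- N%:R * (s' - s)) * weight s L.
Proof.
move=> ss' LN; rewrite /weight big_distrr/= big_seq [leRHS]big_seq.
apply: ler_sum => p /LN Np; rewrite -expRD ler_expR.
have : (N%:R : R) * (s' - s) <= p.2%:R * (s' - s).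
  by rewrite ler_wpM2r ?subr_ge0// ler_nat.
lra.
Qed.

(** Raising the exponent from [s] to [s'] multiplies the weight of a packing of
    order at least [M] by at most [exp (- M (s' - s))], which tends to [0]: a
    finite value at [s] becomes a vanishing limit at [s']. *)
Lemma small_FKpack_eq0 Z s s' eps : 0 <= eps -> s < s' ->
  small s eps Z -> FKpack T Z s' eps = 0%E.
Proof.
move=> e0 ss' [A ZA AN]; apply/eqP; rewrite eq_le; apply/andP; split; last first.
  apply: le_ereal_inf_tmp => _ [B ZB <-]; apply: nneseries_ge0 => *.
  exact: FKpack0_ge0.
apply: ereal_inf_lbound; exists A => //.
apply: eseries0 => i _ _; have [N AN1] := AN i.
set C := fine (FKpackN T (A i) s N eps).
have CE : (FKpackN T (A i) s N eps = C%:E)%E.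
  by rewrite fineK// ge0_fin_numE// FKpackN_ge0.
have C0 : 0 <= C by rewrite fine_ge0// FKpackN_ge0.
have bnd M : (N.+1 <= M)%N ->
    (FKpackN T (A i) s' M eps <= (expR (- M%:R * (s' - s)) * C)%:E)%E.
  move=> NM; apply: FKpackN_le => //; first by case: M NM.
  move=> L pL; have [_ LM _] := pL.
  apply: (@le_trans _ _ (expR (- M%:R * (s' - s)) * weight s L)).
    by apply: weight_le; [exact: ltW|move=> p /LM[]].
  rewrite ler_wpM2l ?expR_ge0// -lee_fin -CE.
  by apply: FKpackN_ge; apply: packingW pL => //; exact: ltnW.
apply/cvg_lim => //.
apply: (@squeeze_cvge _ _ _ _ (fun=> 0%E) _
  (fun M => (expR (- M%:R * (s' - s)) * C)%:E)).
- near=> M; rewrite FKpackN_ge0/= bnd//.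
  by near: M; exists N.+1.
- exact: cvg_cst.
apply: cvg_EFin; first by apply: nearW.
rewrite (_ : _ \o _ = geometric C (expR (- (s' - s)))); last first.
  apply/funext => M /=; rewrite mulrC; congr (_ * _).
  by rewrite -expRM_natl; congr expR; ring.
by apply: cvg_geometric; rewrite ger0_norm ?expR_ge0// expR_lt1 oppr_lt0 subr_gt0.
Unshelve. all: by end_near. Qed.

Lemma not_small_pack s eps A : ~ small s eps A ->
  forall N, FKpackN T A s N eps = +oo%E.
Proof.
move=> nA N; apply/eqP; rewrite -leye_eq leNgt; apply/negP => AN; apply: nA.
by exists (fun=> A) => [x Ax|_]; [exists 0%N|exists N].
Qed.

Lemma smallS s eps A Z : A `<=` Z -> small s eps Z -> small s eps A.
Proof. by move=> AZ [B ZB BN]; exists B => //; exact: subset_trans ZB. Qed.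

Lemma small0 s eps : 0 <= eps -> small s eps set0.
Proof.
move=> e0; exists (fun=> set0) => // _; exists 1%N.
apply: le_lt_trans (ltry 0); apply: FKpackN_le => // -[_|p L [_ + _]].
  by rewrite /weight big_nil.
by move=> /(_ p (mem_head _ _))[].
Qed.

Lemma small_bigcup s eps (A : nat -> set X) : (forall i, small s eps (A i)) ->
  small s eps (\bigcup_i A i).
Proof.
move=> smA; have /choice[B BA] i : exists B : nat -> set X,
    A i `<=` \bigcup_j B j /\
    forall j, exists N, (FKpackN T (B j) s N eps < +oo)%E.
  by have [B] := smA i; exists B.
exists (fun k => if (choice.unpickle k : option (nat * nat)) is Some (i, j)
  then B i j else B 0%N 0%N).
  move=> x [i _ /(BA i).1[j _ Bx]]; exists (choice.pickle (i, j)) => //.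
  by rewrite choice.pickleK.
by move=> k; case: choice.unpickle => [[i j]|]; exact: (BA _).2.
Qed.

Lemma smallU s eps A Z : small s eps A -> small s eps Z -> small s eps (A `|` Z).
Proof.
move=> sA sZ; apply: (@smallS _ _ _ (\bigcup_i (if i is 0%N then A else Z))).
  by move=> x [Ax|Zx]; [exists 0%N|exists 1%N].
by apply: small_bigcup => -[].
Qed.

(** [Z] is what remains of [K] after removing the parts of [K] in the members of
    a countable base that meet [K] in a small set; their union [H] is small. If a
    neighbourhood of a point of [Z] met [Z] in a small set, then adding [H] back
    would make that point one of those removed. *)
Lemma small_core s eps K : 0 <= eps -> compact [set: X] -> ~ small s eps K ->
  exists Z, [/\ Z `<=` K, Z !=set0 &
    forall U, open U -> Z `&` U !=set0 -> ~ small s eps (Z `&` U)].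
Proof.
move=> e0 /compact_second_countable[B Bcnt [Bo Bb]] nK.
pose null G := B G /\ small s eps (K `&` G).
pose H := \bigcup_(G in null) (K `&` G).
have sH : small s eps H.
  have [f Bf] : exists f : nat -> set X, B `<=` range f.
    have [->|/set0P B0] := eqVneq B set0; first by exists (fun=> set0).
    have /(pfcard_geP)[/eqP|[f]] := Bcnt; first by move: B0 => /set0P/negPf ->.
    by exists f; have := @surj _ _ _ _ f.
  apply: (@smallS _ _ _
      (\bigcup_i (if `[< null (f i) >] then K `&` f i else set0))).
    move=> x [G nG KGx]; have [i _ fi] := Bf _ nG.1.
    by exists i => //; rewrite fi asboolT.
  apply: small_bigcup => i; case: ifPn => [/asboolP[]//|_]; exact: small0.
exists (K `\` H); split; first exact: subDsetl.
  apply/set0P; apply/negP => /eqP KH0; apply: nK; apply: smallS sH.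
  by move=> x Kx; apply: contrapT => Hx; have : (K `\` H) x by []; rewrite KH0.
move=> U Uo [x [[Kx Hx] Ux]] sU.
have [G [BG Gx] GU] := Bb x U (open_nbhs_nbhs (conj Uo Ux)).
apply: Hx; exists G => //; split => //.
apply: smallS (smallU sU sH) => y [Ky Gy].
have [Hy|Hy] := pselect (H y); [by right|left].
by split => //; exact: GU.
Qed.

End Packing.

(** * Local entropies on small sets *)

Section Entropy.
Context {R : realType} {X : pointedMetricType R}.
Variable T : X -> X.
Hypothesis contT : continuous T.
Variable mu : probability (borel X) R.
Implicit Types (x y z : X) (Z A : set X) (n N : nat) (s e : R).

Lemma open_borel (U : set X) : open U -> measurable (U : set (borel X)).
Proof. by move=> oU; exact: (@sub_sigma_algebra X [set: X] (@open X)). Qed.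

Lemma measurable_FKball n x e : measurable (FKball T n x e : set (borel X)).
Proof. by apply: open_borel; exact: open_FKball. Qed.

Lemma mu_FKball_fin n x e : mu (FKball T n x e) \is a fin_num.
Proof. by apply: fin_num_measure; exact: measurable_FKball. Qed.

Lemma nbhs_open (A : set X) : (forall x, A x -> nbhs x A) -> open A.
Proof. by move=> nA; rewrite openE. Qed.

(** A ball of radius slightly less than [e] already has mass more than [a], and
    by the triangle inequality it lies in the [e]-balls around nearby points. *)
Lemma mu_FKball_lsc n e (a : \bar R) : open [set x | (a < mu (FKball T n x e))%E].
Proof.
apply: nbhs_open => x /= ax.
have [n0|n0] := posnP n.
  apply: nearW => y /=; rewrite (_ : FKball T n y e = FKball T n x e)//.
  by apply/funext => z; rewrite /FKball/= {}n0 (dFK0E T y z x z).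
pose F k := FKball T n x (e - k.+1%:R^-1).
have UF : \bigcup_k F k = FKball T n x e.
  apply/seteqP; split=> [y [k _]|y]; rewrite /F /FKball/=.
    by move/lt_trans; apply; rewrite gtrBl.
  rewrite -subr_gt0 => /ltr_add_invr[k]; rewrite add0r => ke.
  by exists k => //=; rewrite ltrBrDl -ltrBrDr.
have ndF : nondecreasing_seq F.
  move=> i j ij; apply/subsetPset => y; rewrite /F /FKball/= => /lt_le_trans; apply.
  by rewrite lerB// lef_pV2 ?posrE// ler_nat.
have mF k : measurable (F k : set (borel X)) by exact: measurable_FKball.
have [k ak] : exists k, (a < mu (F k))%E.
  have mUF : measurable (\bigcup_k F k : set (borel X)).
    by rewrite UF; exact: measurable_FKball.
  have cv := nondecreasing_cvg_mu (mu := mu) mF mUF ndF.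
  apply: contrapT => /forallNP Fa; move: ax; apply/negP; rewrite -leNgt -UF.
  rewrite -(cvg_lim _ cv)//; apply: lime_le; first exact: cvgP cv.
  by apply: nearW => k /=; rewrite leNgt; apply/negP/Fa.
have k0 : 0 < k.+1%:R^-1 :> R by [].
apply: filterS (near_dFK contT x n0 k0) => y xy /=.
apply: lt_le_trans ak _; apply: le_measure.
- by apply: mem_set; exact: mF.
- by apply: mem_set; exact: measurable_FKball.
move=> z; rewrite /F /FKball/= => xz.
apply: le_lt_trans (dFK_triangle T n y x z) _; rewrite (dFK_sym T n y x).
by apply: le_lt_trans (lerD xy (lexx _)) _; rewrite -ltrBrDl.
Qed.

Lemma entropy_rate_ltP n x e a : (0 < n)%N ->
  (- lne (mu (FKball T n x e)) / n%:R%:E < a%:E)%E =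
  ((expR (- n%:R * a))%:E < mu (FKball T n x e))%E.
Proof.
move=> n0; rewrite -(fineK (mu_FKball_fin n x e)); set r := fine _.
have r0 : 0 <= r by rewrite fine_ge0// measure_ge0.
have n0' : 0 < n%:R :> R by rewrite ltr0n.
move: r0; rewrite le_eqVlt => /predU1P[<-|r0].
  have -> : lne 0%:E = -oo%E :> \bar R by rewrite /= lexx.
  rewrite inver gt_eqF// gt0_mulye ?lte_fin ?invr_gt0//.
  by rewrite [RHS]ltNge expR_ge0.
rewrite lne_EFin// inver gt_eqF// -EFinN -EFinM !lte_fin ltr_pdivrMr//.
by rewrite -{2}(lnK r0) ltr_expR mulNr mulrC ltrNl.
Qed.

Lemma entropy_rate_ge0 n x e : (0 <= - lne (mu (FKball T n x e)) / n%:R%:E)%E.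
Proof.
apply: mule_ge0; last by rewrite inve_ge0 lee_fin.
rewrite oppe_ge0 lne_le0; apply: probability_le1; exact: measurable_FKball.
Qed.

Lemma local_entropy_ge0 x e : (0 <= local_entropyFK T mu x e)%E.
Proof.
by apply: limf_esup_ge0 => [[N _ /(_ N (leqnn N))]|n] //; exact: entropy_rate_ge0.
Qed.

(** Each term of positive order of the upper limit is upper semicontinuous by
    [entropy_rate_ltP] and [mu_FKball_lsc]. *)
Lemma measurable_local_entropy e :
  measurable_fun [set: borel X] (fun x : borel X => local_entropyFK T mu x e).
Proof.
apply: measurable_fun_limn_esup => n.
have [n0|n0] := posnP n.
  rewrite (_ : (fun x => _) =
      (fun=> (- lne (mu (FKball T n point e)) / n%:R%:E)%E)); last first.
    apply/funext => x; rewrite (_ : FKball T n x e = FKball T n point e)//.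
    by apply/funext => z; rewrite /FKball/= {}n0 (dFK0E T x z point z).
  exact: measurable_cst.
apply: (measurability _ (ErealGenInftyO.measurableE R)) => // _ [_ [a ->] <-].
rewrite setTI; apply: open_borel.
rewrite (_ : _ @^-1` _ =
    [set x | ((expR (- n%:R * a))%:E < mu (FKball T n x e))%E]).
  exact: mu_FKball_lsc.
by apply/funext => x /=; rewrite in_itv/= entropy_rate_ltP.
Qed.

Lemma limn_esup_gt_frequently (u : nat -> \bar R) (l : \bar R) N :
  (l < limn_esup u)%E -> exists2 n, (N <= n)%N & (l < u n)%E.
Proof.
move=> lu; apply: contrapT => H; move: lu; apply/negP; rewrite -leNgt.
apply: (@le_trans _ _ (ereal_sup (u @` [set n | (N <= n)%N]))).
  by apply: ereal_inf_lbound; exists [set n | (N <= n)%N] => //; exists N.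
apply: ge_ereal_sup => _ [n /= Nn <-]; rewrite leNgt; apply/negP => lun.
by apply: H; exists n.
Qed.

(** [L] is a longest sequence of points of [E] whose closed balls of radius [e']
    are disjoint. A point outside all the [e]-balls around [L] could be added to
    it, since two closed balls of radius [e'] with a common point have centres at
    distance at most [2 * e']. *)
Lemma maximal_separated Z s N e e' n (C : R) : (N <= n)%N -> (0 < n)%N ->
  0 < e' -> 2 * e' < e -> FKpackN T Z s N e' = C%:E ->
  forall E : set X, E `<=` Z -> exists L : seq X,
    [/\ forall x, x \in L -> E x,
        forall x, E x -> exists2 y, y \in L & FKball T n y e x &
        (size L)%:R * expR (- n%:R * s) <= C].
Proof.
move=> Nn n0 e'0 e'e FC E EZ.
pose P L := [/\ uniq L, forall x, x \in L -> E x &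
  forall x y, x \in L -> y \in L -> x != y ->
    FKcball T n x e' `&` FKcball T n y e' = set0].
have PC L : P L -> (size L)%:R * expR (- n%:R * s) <= C.
  move=> [uL LE dL].
  have wE : weight s [seq (x, n) | x <- L] = (size L)%:R * expR (- n%:R * s).
    by rewrite /weight big_map /= big_const_seq count_predT iter_addr_0 mulr_natl.
  rewrite -wE -lee_fin -FC; apply: FKpackN_ge; split.
  - by rewrite map_inj_uniq// => x y [].
  - by move=> _ /mapP[x /LE/EZ Zx ->].
  - by move=> _ _ /mapP[x xL ->] /mapP[y yL ->] /= xy; apply: dL => //;
      apply: contraNneq xy => ->.
pose Q k := `[< exists2 L, P L & size L = k >].
have Q0 : exists k, Q k by exists 0%N; apply/asboolP; exists [::] => //; split.
have Qbnd k : Q k -> (k <= Num.truncn (C * expR (n%:R * s)))%N.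
  move=> /asboolP[L PL <-]; rewrite truncn_ge_nat; last first.
    rewrite mulr_ge0 ?expR_ge0//; apply: le_trans (PC _ PL).
    by rewrite mulr_ge0 ?expR_ge0.
  have := PC _ PL; rewrite mulNr expRN -ler_pdivlMr ?invr_gt0 ?expR_gt0//.
  by rewrite invrK.
case: (ex_maxnP Q0 Qbnd) => k /asboolP[L PL kL] kmax.
exists L; split => //; [by case: PL|move=> x Ex|exact: PC].
apply: contrapT => nball.
have nb y : y \in L -> ~ FKball T n y e x by move=> yL yx; apply: nball; exists y.
have disj y : y \in L -> FKcball T n x e' `&` FKcball T n y e' = set0.
  move=> yL; apply/seteqP; split => // z [xz yz]; apply: (nb y yL).
  have := dFK_triangle T n y z x; rewrite /FKball/=.
  by move: xz yz; rewrite /FKcball/= (dFK_sym T n z x); lra.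
suff : (size (x :: L) <= k)%N by rewrite /= kL ltnn.
apply: kmax; apply/asboolP; exists (x :: L) => //; case: PL => uL LE dL; split.
- rewrite /= uL andbT; apply/negP => /nb; apply.
  by rewrite /FKball/= dFKxx//; lra.
- by move=> y; rewrite inE => /predU1P[->//|]; exact: LE.
- move=> y z; rewrite !inE => /predU1P[->|yL] /predU1P[->|zL].
  + by rewrite eqxx.
  + by move=> _; exact: disj.
  + by move=> _; rewrite setIC; exact: disj.
  + exact: dL.
Qed.

(** Borel-Cantelli: a point of [Z] with local entropy above [s'] belongs to
    infinitely many of the sets [E n], and [E n] is covered by at most
    [C exp (n s)] balls of mass at most [exp (- n s')]. *)
Lemma negligible_high_entropy Z s s' N e e' : 0 < e' -> 2 * e' < e ->
  (FKpackN T Z s N e' < +oo)%E -> s < s' ->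
  mu.-negligible (Z `&` [set x | (s'%:E < local_entropyFK T mu x e)%E]).
Proof.
move=> e'0 e'e FC ss'.
have [C CE] : exists C, FKpackN T Z s N e' = C%:E.
  exists (fine (FKpackN T Z s N e')); rewrite fineK// ge0_fin_numE//.
  exact: FKpackN_ge0.
have C0 : 0 <= C by rewrite -lee_fin -CE FKpackN_ge0.
pose q := expR (- (s' - s)).
have q0 : 0 <= q by exact: expR_ge0.
have q1 : q < 1 by rewrite expR_lt1 oppr_lt0 subr_gt0.
pose E n := Z `&` [set x | (mu (FKball T n x e) <= (expR (- n%:R * s'))%:E)%E].
have /choice[V VP] n : exists V : set (borel X),
    [/\ measurable V, (mu V <= (C * q ^+ n)%:E)%E & (N < n)%N -> E n `<=` V].
  have [Nn|nN] := ltnP N n; last first.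
    exists set0; split => //; first by rewrite measure0 lee_fin mulr_ge0 ?exprn_ge0.
  have n0 : (0 < n)%N by case: n Nn.
  have [L [LE EL LC]] := maximal_separated (ltnW Nn) n0 e'0 e'e CE
    (@subIsetl _ Z _ : E n `<=` Z).
  have mU : measurable (\big[setU/set0]_(y <- L) FKball T n y e : set (borel X)).
    by apply: bigsetU_measurable => y _; exact: measurable_FKball.
  exists (\big[setU/set0]_(y <- L) FKball T n y e); split => //.
    apply: (@le_trans _ _ (\sum_(y <- L) mu (FKball T n y e))%E).
      elim: (L) => [|y l IH]; first by rewrite !big_nil measure0.
      rewrite !big_cons; apply: le_trans (leeD2l _ IH).
      apply: measureU2; first exact: measurable_FKball.
      by apply: bigsetU_measurable => z _; exact: measurable_FKball.
    apply: (@le_trans _ _ (\sum_(y <- L) (expR (- n%:R * s'))%:E)%E).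
      rewrite big_seq [leRHS]big_seq; apply: lee_sum => y /LE[_].
      exact.
    rewrite sumEFin lee_fin big_const_seq count_predT iter_addr_0.
    have -> : q ^+ n = expR (n%:R * s) * expR (- n%:R * s').
      by rewrite -expRM_natl -expRD; congr expR; ring.
    rewrite mulrA -[leLHS]mulr_natl ler_wpM2r ?expR_ge0//.
    by move: LC; rewrite mulNr expRN -ler_pdivlMr ?invr_gt0 ?expR_gt0// invrK.
  move=> _ x /EL[y yL yx]; rewrite -bigcup_seq; exists y => //.
have sumV : (\sum_(n <oo) mu (V n) < +oo)%E.
  apply: (@le_lt_trans _ _ (C / (1 - q))%:E); last exact: ltry.
  apply: lime_le; first exact: is_cvg_nneseries.
  apply: nearW => n.
  apply: (@le_trans _ _ (\sum_(0 <= i < n) (C * q ^+ i)%:E)%E).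
    by apply: lee_sum => i _; case: (VP i).
  rewrite sumEFin lee_fin.
  have := geometric_seriesE C (negbT (lt_eqF q1)) => /(congr1 (fun f => f n)).
  rewrite /series /= => ->; rewrite ler_pM2r ?invr_gt0 ?subr_gt0//.
  by rewrite ler_piMr// gerBl exprn_ge0.
exists (lim_sup_set V); split.
- apply: bigcapT_measurable => n; apply: bigcup_measurable => k _.
  by case: (VP k).
- by apply: lim_sup_set_cvg0 => // k; case: (VP k).
move=> x [Zx /= hx] n _.
have [k nk gk] := limn_esup_gt_frequently (maxn n N.+1) hx.
move: nk; rewrite geq_max => /andP[nk Nk]; exists k => //.
have [_ _ EV] := VP k; apply: EV => //; split => //=.
rewrite leNgt -entropy_rate_ltP; last exact: leq_ltn_trans Nk.
by rewrite -leNgt ltW.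
Qed.

(** The local entropy is at most [s + 1 / (k + 1)] almost everywhere on each of
    the countably many pieces of [K], for every [k]. *)
Lemma entropyFK_le K s e e' : 0 < e' -> 2 * e' < e ->
  measurable (K : set (borel X)) ->
  mu K = 1%E -> small T s e' K -> (entropyFK T mu e <= s%:E)%E.
Proof.
move=> e'0 e'e mK muK [Z KZ Zfin].
have ae_le : {ae mu, forall x, setT x -> (local_entropyFK T mu x e <= s%:E)%E}.
  apply: (@negligibleS _ _ _ _ (~` K `|` \bigcup_i \bigcup_k (Z i `&`
      [set x | ((s + k.+1%:R^-1)%:E < local_entropyFK T mu x e)%E]))).
    move=> x /= /not_implyP[_ /negP]; rewrite -ltNge => hx.
    have [Kx|] := pselect (K x); [right|by left].
    have [i _ Zx] := KZ _ Kx; exists i => //.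
    suff [k hk] : exists k, ((s + k.+1%:R^-1)%:E < local_entropyFK T mu x e)%E.
      by exists k.
    move: hx; case: local_entropyFK => [r| |]; rewrite ?lte_fin ?ltry//.
      by move=> /ltr_add_invr[k]; exists k; rewrite lte_fin.
    by exists 0%N; rewrite ltry.
  apply: negligibleU.
    apply/negligibleP; first exact: measurableC.
    by have := probability_setC mu mK; rewrite muK subee.
  apply: negligible_bigcup => i; apply: negligible_bigcup => k.
  have [N FN] := Zfin i; apply: negligible_high_entropy FN _ => //.
  by rewrite ltrDl.
(* the local entropy is nonnegative and at most [s] at some point *)
have s0 : 0 <= s.
  have PF : ProperFilter (almost_everywhere mu).
    have mu0 : (0 < mu [set: borel X])%E by rewrite probability_setT.
    exact: ae_properfilter_algebraOfSetsType.
  have [x /(_ I) hx] := filter_ex ae_le.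
  by rewrite -lee_fin; apply: le_trans hx; exact: local_entropy_ge0.
have <- : (\int[mu]_x (cst s%:E) x = s%:E)%E.
  by rewrite integral_cst// [X in (_ * X)%E](probability_setT mu) mule1.
apply: ae_ge0_le_integral => //.
- by move=> x _; exact: local_entropy_ge0.
- exact: measurable_local_entropy.
Qed.

End Entropy.

(** * Refining a tree of separated nodes *)

Lemma common_radius (R : realType) (I : eqType) (P : I -> R -> Prop) (l : seq I) :
  (forall i r r', P i r -> r' <= r -> P i r') ->
  (forall i, i \in l -> exists2 r, 0 < r & P i r) ->
  exists2 r, 0 < r & forall i, i \in l -> P i r.
Proof.
move=> Pmono; elim: l => [_|i l IH lP]; first by exists 1.
have [r r0 Pr] := lP i (mem_head _ _).
have [|r' r'0 Pr'] := IH; first by move=> j jl; apply: lP; rewrite inE jl orbT.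
exists (Num.min r r'); first by rewrite lt_min r0.
move=> j; rewrite inE => /predU1P[->|jl].
  by apply: Pmono Pr _; rewrite ge_min lexx.
by apply: (Pmono _ _ _ (Pr' j jl)); rewrite ge_min lexx orbT.
Qed.

(** Greedy allocation: the weights [c i] are laid end to end from [a], and the
    last pieces are truncated at [b] (or empty). Hence the weights only need to
    have a large enough sum, and never have to be renormalised. *)
Lemma split_interval (R : realType) (I : eqType) (d : I) (c : I -> R) (E : seq I)
    (a b : R) : (forall i, 0 <= c i) -> uniq E -> b - a <= \sum_(i <- E) c i ->
  exists g : R -> I, (forall t, a <= t < b -> g t \in E) /\
    forall i, i \in E -> exists a' b', b' - a' <= c i /\
      forall t, (a <= t < b) && (g t == i) = (a' <= t < b').
Proof.
move=> c0; elim: E a => [a _|i E IH a /= /andP[iE uE]].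
  rewrite big_nil subr_le0 => ba; exists (fun=> d); split => // t.
  by move=> /andP[/le_lt_trans tb /tb]; rewrite ltNge ba.
rewrite big_cons => abE; have [|g [gE glen]] := IH (a + c i) uE; first by lra.
have ci := c0 i.
exists (fun t => if t < a + c i then i else g t); split.
  move=> t /andP[at_ tb]; rewrite inE; case: ltP => [_|ct]; first by rewrite eqxx.
  by rewrite gE ?orbT// ct.
move=> j; rewrite inE => /predU1P[->|jE].
  exists a, (Num.min (a + c i) b); split.
    by rewrite lerBlDr ge_min addrC lexx.
  move=> t; rewrite lt_min; case: (ltP t (a + c i)) => ct /=.
    by rewrite eqxx andbT.
  rewrite andbF; apply/negbTE/negP => /andP[/andP[_ tb] /eqP gi].
  by move: iE; rewrite -gi gE// ct.
have ji : i != j by apply: contraNneq iE => ->.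
have [a' [b' [lab tab]]] := glen j jE; exists a', b'; split => // t.
rewrite -tab; case: (ltP t (a + c i)) => ct /=.
  by rewrite (negbTE ji) andbF.
by rewrite (le_trans _ ct)// lerDl.
Qed.

Section Tree.
Context {R : realType} {X : pointedMetricType R}.
Variable T : X -> X.
Hypothesis contT : continuous T.
Variables (s eps : R) (Z : set X).
Hypotheses (s0 : 0 <= s) (eps0 : 0 <= eps).
Hypothesis Z_thick : forall U, open U -> Z `&` U !=set0 ->
  ~ small T s eps (Z `&` U).
Implicit Types (x y z : X) (n N : nat).
Implicit Types (L E : seq (X * nat)) (F : R -> X * nat).

Lemma open_mball x (r : R) : open [set y | mdist x y < r].
Proof.
apply: nbhs_open => y /= xy; apply/nbhs_ballP.
exists (r - mdist x y); first by rewrite /= subr_gt0.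
move=> z; rewrite ballEmdist /= => yz.
by apply: le_lt_trans (metric_triangle _ y _) _; rewrite -ltrBrDl.
Qed.

Lemma expR_le1 n : expR (- n%:R * s) <= 1.
Proof. by rewrite -expR0 ler_expR mulNr oppr_le0 mulr_ge0. Qed.

Lemma packing_subset A N L L' : uniq L' -> {subset L' <= L} ->
  packing T A N eps L -> packing T A N eps L'.
Proof.
move=> uL' L'L [uL LA dL]; split => // [p /L'L|p q /L'L pL /L'L qL].
  exact: LA.
exact: dL.
Qed.

(** Disjointness of the balls means that each point of [P] is in at most one of
    them, and a single ball weighs at most [1]. *)
Lemma packing_avoid A N (P : seq X) L : packing T A N eps L ->
  exists L', [/\ packing T A N eps L',
    forall p x, p \in L' -> x \in P -> ~ FKcball T p.2 p.1 eps x &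
    weight s L <= weight s L' + (size P)%:R].
Proof.
elim: P L => [|x P IH] L pL; first by exists L; split => //; rewrite addr0.
have [L1 [pL1 avL1 wL1]] := IH L pL.
have [[p pin px]|nx] := pselect (exists2 p, p \in L1 & FKcball T p.2 p.1 eps x).
  have uL1 : uniq L1 by case: pL1.
  exists (rem p L1); split.
  - apply: packing_subset pL1; first exact: rem_uniq.
    exact: mem_rem.
  - move=> q y; rewrite mem_rem_uniq// inE => /andP[qp qL1].
    rewrite inE => /predU1P[->|yP]; last exact: avL1.
    case: pL1 => _ _ /(_ p q pin qL1); rewrite eq_sym => /(_ qp) d qx.
    by have : (FKcball T p.2 p.1 eps `&` FKcball T q.2 q.1 eps) x by []; rewrite d.
  - apply: le_trans wL1 _; rewrite /weight (perm_big _ (perm_to_rem pin)) /=.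
    by rewrite big_cons -natr1 -/(weight _ _); have := expR_le1 p.2; lra.
exists L1; split => //; last first.
  by apply: le_trans wL1 _; rewrite lerD2l ler_nat.
move=> q y qL1; rewrite inE => /predU1P[->|]; last exact: avL1.
by move=> qx; apply: nx; exists q.
Qed.

Lemma extract_packing (U : set X) N (P : seq X) : open U -> Z `&` U !=set0 ->
  exists E, [/\ packing T (Z `&` U) N.+1 eps E,
    forall p x, p \in E -> x \in P -> ~ FKcball T p.2 p.1 eps x &
    1 <= weight s E].
Proof.
move=> Uo ZU; have infty := not_small_pack (Z_thick Uo ZU) N.+1.
(* the surplus [size P] is what avoiding the points of [P] may cost *)
have [L [pL wL]] : exists L, packing T (Z `&` U) N.+1 eps L /\
    1 + (size P)%:R < weight s L.
  apply: contrapT => /forallNP H.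
  suff : (FKpackN T (Z `&` U) s N.+1 eps <= (1 + (size P)%:R)%:E)%E.
    by rewrite infty.
  apply: FKpackN_le => // L pL; rewrite leNgt; apply/negP => wL.
  by apply: (H L).
have [E [pE avE wE]] := packing_avoid P pL.
by exists E; split => //; lra.
Qed.

(** A stage of the tree, with node set [L]; [F t] is the node whose interval
    contains [t]. Only parameters in [0, 1[ matter. The third clause is the
    separation of the points themselves; by openness it extends to
    neighbourhoods ([tree_stage_separated]). The last one bounds the interval of
    a node [(x, m)] by [exp (- m s)], which becomes the bound on the mass of
    balls of order [m]. *)
Definition tree_stage L F :=
  [/\ forall t, 0 <= t < 1 -> F t \in L,
      forall p, p \in L -> Z p.1,
      forall p q, p \in L -> q \in L -> p != q -> eps < dFK T p.2 p.1 q.1 &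
      forall p, p \in L -> exists a b, b - a <= expR (- p.2%:R * s) /\
        forall t, (0 <= t < 1) && (F t == p) = (a <= t < b)].

Definition dFK_separated L r := forall p q, p \in L -> q \in L -> p != q ->
  forall x y, mdist p.1 x < r -> mdist q.1 y < r -> eps < dFK T p.2 x y.

Lemma tree_stage_separated L F : tree_stage L F ->
  exists2 r, 0 < r & dFK_separated L r.
Proof.
move=> [_ _ sepL _].
have [|pq|r r0 rP] := @common_radius R _ (fun pq r => pq.1 != pq.2 ->
    forall x y, mdist pq.1.1 x < r -> mdist pq.2.1 y < r ->
    eps < dFK T pq.1.2 x y) [seq (p, q) | p <- L, q <- L].
- by move=> i r r' + r'r ineq x y xr yr => /(_ ineq); apply; exact: lt_le_trans r'r.
- move=> /allpairsP[[p q] [/= pL qL ->]] /=.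
  have [<-|pq_neq] := eqVneq p q; first by exists 1.
  have [r r0 rP] := dFK_gt_near contT (sepL p q pL qL pq_neq).
  by exists r => // _; exact: rP.
exists r => // p q pL qL pq; apply: (rP (p, q)) pq.
by apply/allpairsP; exists (p, q).
Qed.

(** Replaces the node [p] by a packing within distance [r] of its point, all of
    whose orders exceed [N]. The separation is preserved for three reasons: an
    old ball misses the children, which are close to the point of [p]; a child's
    ball misses the old points, which the packing avoids; and the balls of two
    children are disjoint. *)
Lemma refine_node L F p N r : tree_stage L F -> p \in L -> 0 < r ->
  exists L' F', [/\ tree_stage L' F',
    forall t, 0 <= t < 1 -> mdist (F t).1 (F' t).1 < r &
    count (fun q => (q.2 <= N)%N) L' =
    count (fun q => (q.2 <= N)%N && (q != p)) L].
Proof.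
move=> aL pL r0; have [r1 r10 sepr] := tree_stage_separated aL.
case: (aL) => FL LZ sepL lenL.
pose r2 := Num.min r r1; have r20 : 0 < r2 by rewrite lt_min r0.
have ZU : Z `&` [set y | mdist p.1 y < r2] !=set0.
  by exists p.1; split; [exact: LZ|rewrite /= mdistxx].
have Uo : open [set y | mdist p.1 y < r2].
  exact: open_mball.
have [E [[uE EZ dE] avE wE]] := extract_packing N [seq q.1 | q <- L] Uo ZU.
have Epos q : q \in E -> (0 < q.2)%N by move=> /EZ[_]; exact: leq_trans.
have Eclose q : q \in E -> mdist p.1 q.1 < r2 by move=> /EZ[[]].
have EL q q' : q \in E -> q' \in L -> eps < dFK T q.2 q.1 q'.1.
  move=> qE q'L; rewrite ltNge; apply/negP; apply: avE => //.
  exact: map_f.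
have ENL q : q \in E -> q \notin L.
  move=> qE; apply/negP => qL; have := EL q q qE qL.
  by rewrite dFKxx ?Epos// ltNge eps0.
have [a [b [ab tab]]] := lenL p pL.
have [|g [gE glen]] := @split_interval R _ p (fun q => expR (- q.2%:R * s)) E a b
    (fun=> expR_ge0 _) uE.
  by apply: le_trans ab _; apply: le_trans wE; exact: expR_le1.
pose L' := [seq q <- L | q != p] ++ E.
pose F' t := if F t == p then g t else F t.
have F'E t : 0 <= t < 1 -> F t == p -> F' t \in E.
  by move=> t01 Fp; rewrite /F' Fp gE// -tab t01.
exists L', F'; split.
- split.
  + move=> t t01; rewrite mem_cat; case: (boolP (F t == p)) => Fp.
      by rewrite F'E ?orbT.
    by rewrite /F' (negbTE Fp) mem_filter Fp FL.
  + move=> q; rewrite mem_cat mem_filter => /orP[/andP[_ /LZ]//|].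
    by move=> /EZ[[]].
  + move=> q q'; rewrite !mem_cat !mem_filter.
    move=> /orP[/andP[qp qL]|qE] /orP[/andP[q'p q'L]|q'E] qq'.
    * exact: sepL.
    * apply: (sepr q p) => //; first by rewrite mdistxx.
      by apply: lt_le_trans (Eclose _ q'E) _; rewrite ge_min lexx orbT.
    * exact: EL.
    * rewrite ltNge; apply/negP => qq'e.
      have : (FKcball T q.2 q.1 eps `&` FKcball T q'.2 q'.1 eps) q'.1.
        by split => //; apply: FKcball_center => //; exact: Epos.
      by rewrite dE.
  + move=> q; rewrite mem_cat mem_filter => /orP[/andP[qp qL]|qE].
      have [a' [b' [lab' tab']]] := lenL q qL; exists a', b'; split => // t.
      rewrite -tab'; case: (boolP (0 <= t < 1)) => //= t01.
      rewrite /F'; case: (boolP (F t == p)) => // Fp.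
      rewrite (eqP Fp) [p == q]eq_sym (negbTE qp); apply/negbTE.
      have := F'E t t01 Fp; rewrite /F' Fp => gtE.
      by apply: contraL qL => /eqP <-; exact: ENL.
    have [a' [b' [lab' tab']]] := glen q qE; exists a', b'; split => // t.
    rewrite -tab' -tab /F'; case: (boolP (F t == p)) => Fp; first by rewrite andbT.
    rewrite andbF /=; apply/negbTE/negP => /andP[t01 /eqP Fq].
    by have := ENL q qE; rewrite -Fq FL.
- move=> t t01; rewrite /F'; case: (boolP (F t == p)) => Fp; last by rewrite mdistxx.
  have := F'E t t01 Fp; rewrite /F' Fp => /Eclose; rewrite (eqP Fp) => /lt_le_trans.
  by apply; rewrite ge_min lexx.
rewrite count_cat (_ : count _ E = 0%N) ?addn0 ?count_filter//.
apply/eqP; rewrite -leqn0 leqNgt -has_count; apply/hasPn => q /EZ[_].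
by rewrite ltnNge.
Qed.

(** Nodes of order at most [N] are replaced one by one, their number being the
    termination measure. A parameter moves once for each replacement of its
    node, so the allowed displacement is halved at every step. *)
Lemma refine L F N r : tree_stage L F -> 0 < r ->
  exists L' F', [/\ tree_stage L' F',
    forall t, 0 <= t < 1 -> mdist (F t).1 (F' t).1 < r &
    forall q, q \in L' -> (N < q.2)%N].
Proof.
have [k] := ubnP (count (fun q : X * nat => (q.2 <= N)%N) L).
elim: k => // k IH in L F r *; rewrite ltnS => Lk aL r0.
have [/hasP[p pL pN]|/hasPn LN] := boolP (has (fun q : X * nat => (q.2 <= N)%N) L);
    last first.
  exists L, F; split => // [t _|q /LN]; first by rewrite mdistxx.
  by rewrite -ltnNge.
have r20 : 0 < r / 2 by rewrite divr_gt0.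
have [L1 [F1 [aL1 F1r cL1]]] := refine_node N aL pL r20.
have [|//|//|L' [F' [aL' F'r L'N]]] := IH L1 F1 (r / 2).
  apply: leq_trans Lk; rewrite cL1 !(permP (perm_to_rem pL)).
  rewrite /= pN eqxx /= add0n add1n ltnS; apply: sub_count => q /=.
  by case/andP.
exists L', F'; split => // t t01.
apply: le_lt_trans (metric_triangle _ (F1 t).1 _) _.
by rewrite (splitr r) ltrD ?F1r ?F'r.
Qed.

End Tree.

(** * The limit measure *)

Section UnitInterval.
Context (R : realType).

Definition unit_lebesgue : set (measurableTypeR R) -> \bar R :=
  mrestr (@lebesgue_measure R) (measurable_itv `[0%R, 1%R[).

HB.instance Definition _ := Measure.on unit_lebesgue.

Lemma unit_lebesgueT : unit_lebesgue setT = 1%E.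
Proof.
rewrite /unit_lebesgue /mrestr setTI lebesgue_measure_itv/= lte_fin.
by rewrite ltr01 oppr0 adde0.
Qed.

HB.instance Definition _ := Measure_isProbability.Build _ _ _ unit_lebesgue
  unit_lebesgueT.

Lemma unit_lebesgue_le (A : set R) (a b c : R) : 0 <= c -> b - a <= c ->
  measurable A -> (forall t, 0 <= t < 1 -> A t -> a <= t < b) ->
  (unit_lebesgue A <= c%:E)%E.
Proof.
move=> c0 abc mA Aab.
apply: (@le_trans _ _ (lebesgue_measure `[a, b[%classic)).
  apply: le_measure.
  - by apply: mem_set; exact: measurableI.
  - exact: mem_set.
  - by move=> t /= [At]; rewrite !in_itv/= => t01; exact: Aab.
rewrite lebesgue_measure_itv/=; case: ifPn => _; last by rewrite lee_fin.
by rewrite -EFinB lee_fin.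
Qed.

(** Makes maps that matter on [0, 1[ only into total ones without changing their
    distribution under [unit_lebesgue]. *)
Definition clamp (t : R) : R := if 0 <= t < 1 then t else 0.

Lemma clamp01 t : 0 <= clamp t < 1.
Proof. by rewrite /clamp; case: ifPn => //; rewrite lexx ltr01. Qed.

Lemma clampE t : 0 <= t < 1 -> clamp t = t.
Proof. by rewrite /clamp => ->. Qed.

Lemma measurable_clamp : measurable_fun setT clamp.
Proof.
rewrite /clamp; apply: measurable_fun_ifT => //.
by apply: measurable_and => //; [exact: measurable_fun_ler|exact: measurable_fun_ltr].
Qed.

End UnitInterval.

Section MeasureOnTree.
Context {R : realType} {X : pointedMetricType R}.
Variable T : X -> X.
Hypothesis contT : continuous T.
Variables (s eps : R) (K Z : set X).
Hypotheses (s0 : 0 <= s) (eps0 : 0 <= eps).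
Hypothesis compactK : compact K.
Hypotheses (ZK : Z `<=` K) (Z0 : Z !=set0).
Hypothesis Z_thick : forall U, open U -> Z `&` U !=set0 ->
  ~ small T s eps (Z `&` U).

Let A := (seq (X * nat) * (R -> X * nat) * R)%type.
(** The radius [a.2] records how far points may still move without spoiling the
    separation of the nodes. *)
Let good (a : A) :=
  [/\ tree_stage T s eps Z a.1.1 a.1.2, 0 < a.2 & dFK_separated T eps a.1.1 a.2].

(** The displacement from stage [k] to stage [k + 1] is below [r k / 2], and
    [r] at least halves, so the total displacement after stage [k] stays below
    [r k], the radius for which the nodes of stage [k] are separated. *)
Lemma tree_sequence : exists (L : nat -> seq (X * nat)) (F : nat -> R -> X * nat)
    (r : nat -> R),
  [/\ forall k, tree_stage T s eps Z (L k) (F k),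
      forall k, [/\ 0 < r k, r k <= 2^-1 ^+ k & r k.+1 <= r k / 2],
      forall k, dFK_separated T eps (L k) (r k),
      forall k t, 0 <= t < 1 -> mdist (F k t).1 (F k.+1 t).1 < r k / 2 &
      forall k p, p \in L k.+1 -> (k < p.2)%N].
Proof.
case: Z0 => z Zz.
(* order [0] makes the initial bound [exp 0 = 1] match the length of [0, 1[ *)
pose a0 : A := ([:: (z, 0%N)], fun=> (z, 0%N), 1).
have ga0 : good a0.
  split => //=; last first.
    by move=> p q; rewrite !inE => /eqP -> /eqP ->; rewrite eqxx.
  split => //=.
  - by move=> t _; rewrite mem_head.
  - by move=> p; rewrite inE => /eqP ->.
  - by move=> p q; rewrite !inE => /eqP -> /eqP ->; rewrite eqxx.
  - move=> p; rewrite inE => /eqP ->; exists 0, 1; split => [|t].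
      by rewrite subr0 /= mulNr mul0r oppr0 expR0.
    by rewrite eqxx andbT.
have /choice[next nextP] (u : nat * {a : A | good a}) :
    exists v : {a : A | good a}, let a := sval u.2 in let b := sval v in
      [/\ b.2 <= a.2 / 2,
      forall t, 0 <= t < 1 -> mdist (a.1.2 t).1 (b.1.2 t).1 < a.2 / 2 &
      forall p, p \in b.1.1 -> (u.1 < p.2)%N].
  case: u => k [[[L F] r] [/= aLF r0 _]].
  have r20 : 0 < r / 2 by rewrite divr_gt0.
  have [L' [F' [aL' F'r L'k]]] := refine contT s0 eps0 Z_thick k aLF r20.
  have [r' r'0 sepr'] := tree_stage_separated contT aL'.
  have g : good (L', F', Num.min r' (r / 2)).
    split => //=; first by rewrite lt_min r'0.
    move=> p q pL qL pq x y; rewrite !lt_min => /andP[px _] /andP[qy _].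
    exact: (sepr' p q).
  by exists (exist _ _ g); split => //=; rewrite ge_min lexx orbT.
pose S := fix S k := if k is k'.+1 then next (k', S k') else exist _ a0 ga0.
have SP k := nextP (k, S k).
have Sgood k := svalP (S k).
exists (fun k => (sval (S k)).1.1), (fun k => (sval (S k)).1.2),
  (fun k => (sval (S k)).2); split.
- by move=> k; case: (Sgood k).
- have rS k : (sval (S k.+1)).2 <= (sval (S k)).2 / 2 by case: (SP k).
  move=> k; split => //; first by case: (Sgood k).
  elim: k => [|k IH]; first by rewrite expr0.
  by apply: le_trans (rS k) _; rewrite exprS mulrC ler_pM2l ?invr_gt0//.
- by move=> k; case: (Sgood k).
- by move=> k t t01; case: (SP k) => _ /(_ t t01).
- by move=> k p; case: (SP k) => _ _ /(_ p).
Qed.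

(** The limit is taken to be a cluster point, which compactness provides; the
    estimates on [mdist (u k) (u (k + j))] pass to it, and the last step, from
    [k] to [k + 1], keeps the final inequality strict. *)
Lemma limit_map (u : nat -> X) (r : nat -> R) :
  (forall k, K (u k)) ->
  (forall k, 0 < r k /\ r k.+1 <= r k / 2) ->
  (forall k, mdist (u k) (u k.+1) < r k / 2) ->
  exists2 x, K x & forall k, mdist (u k) x < r k.
Proof.
move=> Ku rP uu.
have cauchy k j : mdist (u k) (u (k + j)%N) + r (k + j)%N <= r k.
  elim: j => [|j]; first by rewrite addn0 mdistxx add0r.
  rewrite addnS; have [_ rS] := rP (k + j)%N.
  have := metric_triangle (u k) (u (k + j)%N) (u (k + j).+1).
  by have := uu (k + j)%N; lra.
have FK : (u @ \oo) K by exists 0%N => // n _; exact: Ku.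
have [x [Kx clx]] := compactK _ FK.
have ux k : mdist (u k) x <= r k.
  apply/ler_addgt0Pr => e e0.
  have uk : (u @ \oo) (u @` [set n | (k <= n)%N]) by exists k => // n kn; exists n.
  have [_ [[n /= kn <-]]] := clx _ _ uk (nbhsx_ballx x e e0).
  rewrite ballEmdist /= metric_sym => xn.
  have := cauchy k (n - k)%N; rewrite subnKC// => c.
  have [rn _] := rP n.
  by have := metric_triangle (u k) (u n) x; lra.
exists x => // k; have [r0 rS] := rP k.
by have := metric_triangle (u k) (u k.+1) x; have := ux k.+1; have := uu k; lra.
Qed.

(** Fix a parameter [t], a stage [k] and the node [p] of [t] at that stage. If
    [f u] is in the ball of order [p.2] around [f t], then [u] has the same node
    [p], because distinct nodes stay separated in the limit. So the image measure
    of the ball is at most the length of the interval of [p], that is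
    [exp (- p.2 s)]; and [p.2] tends to infinity with [k]. *)
Lemma exists_entropy_ge : exists mu : probability (borel X) R,
  mu K = 1%E /\ (s%:E <= entropyFK T mu eps)%E.
Proof.
have [L [F [r [stL rP sepL FF LN]]]] := tree_sequence.
have FL k t : 0 <= t < 1 -> F k t \in L k by case: (stL k) => + _ _ _; apply.
have /choice[f fP] t : exists x, K x /\
    forall k, mdist (F k (clamp t)).1 x < r k.
  have t01 := clamp01 t.
  have [|k|k|x Kx xr] := @limit_map (fun k => (F k (clamp t)).1) r.
  - by move=> k; apply: ZK; case: (stL k) => _ + _ _; apply; exact: FL.
  - by case: (rP k).
  - exact: FF.
  - by exists x.
(* a map with finitely many values, each taken on an interval *)
have mF k (B : set (X * nat)) : measurable [set t : R | B (F k (clamp t))].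
  rewrite (_ : [set t | _] = \bigcup_(p in [set` L k])
      (if `[< B p >] then [set t | F k (clamp t) = p] else set0)).
    apply: fin_bigcup_measurable => // p pL; case: ifPn => // _.
    case: (stL k) => _ _ _ /(_ p pL)[a [b [_ tab]]].
    rewrite (_ : [set t | _] = @clamp R @^-1` `[a, b[).
      by rewrite -[_ @^-1` _]setTI; exact: measurable_clamp.
    apply/seteqP; split=> t /=; rewrite in_itv/= -tab clamp01 => /eqP.
      by [].
    by [].
  apply/seteqP; split=> [t /= Bt|t [p /= pL]].
    exists (F k (clamp t)) => /=; first by apply: FL; exact: clamp01.
    by rewrite asboolT.
  by case: ifPn => [/asboolP Bp /= ->|].
have mf : measurable_fun [set: measurableTypeR R] (f : _ -> borel X).
  apply: (@measurability _ _ (measurableTypeR R) (borel X) _ f (@open X) erefl).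
  move=> _ [U oU <-]; rewrite setTI.
  (* [f t] is in [U] iff a whole ball around some approximation of it is *)
  rewrite (_ : f @^-1` U = \bigcup_k [set t |
      [set y | mdist (F k (clamp t)).1 y < r k] `<=` U]).
    apply: bigcupT_measurable => k.
    exact: (mF k [set p | [set y | mdist p.1 y < r k] `<=` U]).
  apply/seteqP; split=> [t /= Uft|t [k _ /= kU]]; last first.
    by apply: kU; case: (fP t) => _; apply.
  have /nbhs_ballP[d /= d0 dU] := open_nbhs_nbhs (conj oU Uft).
  have [k kd] : exists k, r k + r k < d.
    have [k kd] : exists k, (2^-1 : R) ^+ k < d / 2.
      have half1 : `|2^-1 : R| < 1 by rewrite ger0_norm ?invr_ge0// invf_lt1// ltr1n.
      have d20 : 0 < d / 2 by rewrite divr_gt0.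
      have /cvgrPdist_lt/(_ _ d20)[k _ /(_ k (leqnn k))/=] := cvg_expr half1.
      by rewrite sub0r normrN ger0_norm ?exprn_ge0 ?invr_ge0//; exists k.
    by exists k; have [_ rk _] := rP k; lra.
  exists k => // y /= ky; apply: dU; rewrite ballEmdist /=.
  apply: le_lt_trans (metric_triangle _ (F k (clamp t)).1 _) _.
  by have [_ /(_ k)] := fP t; rewrite metric_sym => fk; lra.
pose fm : {mfun measurableTypeR R >-> borel X} :=
  HB.pack (f : measurableTypeR R -> borel X) (isMeasurableFun.Build _ _ _ _ _ mf).
pose mu : probability (borel X) R := distribution (@unit_lebesgue R) fm.
exists mu; split.
  rewrite /mu /= /distribution /pushforward (_ : fm @^-1` K = setT).
    exact: unit_lebesgueT.
  by apply/seteqP; split => // t _; case: (fP t).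
have rate_ge t k : exists2 n, (k < n)%N &
    (s%:E <= - lne (mu (FKball T n (f t) eps)) / n%:R%:E)%E.
  have t01 := clamp01 t; have pL := FL k.+1 _ t01.
  set p := F k.+1 (clamp t) in pL; have kp := LN k p pL.
  exists p.2 => //; rewrite leNgt entropy_rate_ltP//; last exact: leq_ltn_trans kp.
  rewrite -leNgt; case: (stL k.+1) => _ _ _ /(_ p pL)[a [b [ab tab]]].
  apply: (@unit_lebesgue_le _ _ a b) => //.
    by rewrite -[X in measurable X]setTI; apply: (mf) => //; exact: measurable_FKball.
  move=> u u01; rewrite /= /FKball /= => fu; rewrite -tab u01 /=.
  apply: contraTT fu => Fp; rewrite -leNgt ltW//.
  apply: (sepL k.+1 p (F k.+1 u)) => //; first exact: FL.
  - by rewrite eq_sym.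
  - by case: (fP t) => _; apply.
  - by case: (fP u) => _; rewrite clampE.
have le_local t : (s%:E <= local_entropyFK T mu (f t) eps)%E.
  apply: le_ereal_inf_tmp => _ [V [N _ NV] <-].
  have [n Nn sn] := rate_ge t N.
  by apply: le_ereal_sup_tmp; exists (- lne (mu (FKball T n (f t) eps)) / n%:R%:E)%E;
    [exists n => //; apply: NV; exact: ltnW|].
rewrite /entropyFK ge0_integral_distribution//; last 2 first.
- exact: measurable_local_entropy.
- by move=> y; exact: local_entropy_ge0.
have <- : (\int[unit_lebesgue (R := R)]_x (cst s%:E) x = s%:E)%E.
  by rewrite integral_cst// [X in (_ * X)%E]unit_lebesgueT mule1.
apply: ge0_le_integral => //.
- by apply: measurableT_comp (mf) => //; exact: measurable_local_entropy.
- by move=> t _; exact: le_local.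
Qed.

End MeasureOnTree.

(** * The variational principle *)

Section Variational.
Context {R : realType} {X : pointedMetricType R}.
Variables (T : X -> X) (K : set X).
Hypotheses (compactX : compact [set: X]) (contT : continuous T).
Hypotheses (K_neq0 : K !=set0) (compactK : compact K).
Implicit Types (eps s : R).

Let sup_entropy eps := ereal_sup [set entropyFK T mu eps |
  mu in [set mu : probability (borel X) R | mu K = 1%E]].

Lemma measurable_compact : measurable (K : set (borel X)).
Proof.
rewrite -(setCK K); apply: measurableC; apply: open_borel; apply: closed_openC.
by apply: compact_closed => //; exact: metric_hausdorff.
Qed.

Lemma sup_entropy_ge0 eps : (0 <= sup_entropy eps)%E.
Proof.
have [x Kx] := K_neq0.
apply: le_ereal_sup_tmp.
exists (entropyFK T (\d_(x : borel X) : probability (borel X) R) eps).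
  by exists (\d_(x : borel X)) => //=; rewrite diracE mem_set.
by apply: integral_ge0 => y _; exact: local_entropy_ge0.
Qed.

(** If the supremum [r] were below the critical value, there would be exponents
    [r < a < b] still below it. Then [K] is not small at [a], and the measure
    built at exponent [a] has entropy at least [a]. *)
Lemma FKpack_crit_le_sup_entropy eps : 0 < eps ->
  (FKpack_crit T K eps <= sup_entropy eps)%E.
Proof.
move=> eps0; rewrite leNgt; apply/negP => lt_crit.
have [a [b [a0 ab supa bcrit]]] : exists a b : R,
    [/\ 0 <= a, a < b, (sup_entropy eps < a%:E)%E & (b%:E < FKpack_crit T K eps)%E].
  move: lt_crit (sup_entropy_ge0 eps).
  case: (sup_entropy eps) => [r| |]//; case: FKpack_crit => [c| |]//.
    rewrite !lte_fin lee_fin => rc r0.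
    by exists (r + (c - r) / 3), (r + (c - r) / 2); rewrite !lte_fin; split; lra.
  rewrite lee_fin => _ r0; exists (r + 1), (r + 2).
  by rewrite lte_fin ltry; split => //; lra.
have [smallK|nsmallK] := pselect (small T a eps K).
  have K0 := small_FKpack_eq0 (ltW eps0) ab smallK.
  by move: bcrit; apply/negP; rewrite -leNgt; apply: ereal_inf_lbound; exists b.
have [Z [ZK Z0 Zthick]] := small_core (ltW eps0) compactX nsmallK.
have [mu [muK mua]] := exists_entropy_ge contT a0 (ltW eps0) compactK ZK Z0 Zthick.
move: supa; apply/negP; rewrite -leNgt; apply: le_trans mua _.
by apply: ereal_sup_ubound; exists mu.
Qed.

Lemma sup_entropy_le_FKpack_crit eps : 0 < eps ->
  (sup_entropy eps <= FKpack_crit T K (eps / 3))%E.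
Proof.
move=> eps0; apply: ge_ereal_sup => _ [mu muK <-].
apply: le_ereal_inf_tmp => _ [s Ks <-].
apply: (@entropyFK_le _ _ _ contT _ K _ _ (eps / 3)) => //.
- by rewrite divr_gt0.
- by lra.
- exact: measurable_compact.
- exact: FKpack_eq0_small.
Qed.

End Variational.

(** For [c' < c], the inequality [c' * ln (3 / e) <= c * ln (1 / e)] holds as soon
    as [ln (1 / e) >= c' * ln 3 / (c - c')]; so any bound [c'] for the quotients
    of [f] near [0] gives the bound [c] for those of [g]. *)
Lemma limf_esup_div_ln (R : realType) (f g : R -> \bar R) :
  (forall e : R, 0 < e -> (f e <= g e)%E) ->
  (forall e : R, 0 < e -> (g e <= f (e / 3)%R)%E) ->
  limf_esup (fun e : R => f e / (ln (1 / e)%R)%:E)%E 0^'+ =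
  limf_esup (fun e : R => g e / (ln (1 / e)%R)%:E)%E 0^'+.
Proof.
move=> fg gf.
have ln0 (e : R) : 0 < e < 1 -> 0 < ln (1 / e).
  by move=> /andP[e0 e1]; rewrite ln_gt0// div1r invf_gt1.
have ediv (r : R) x y : 0 < r -> (y / r%:E <= x)%E = (y <= x * r%:E)%E.
  by move=> r0; rewrite inver gt_eqF// lee_pdivrMr.
have interval (d : R) : 0 < d -> 0^'+ [set e : R | 0 < e < d].
  move=> d0; near=> e; apply/andP; split; first by near: e; exact: nbhs_right_gt.
  by near: e; exact: nbhs_right_lt.
apply/eqP; rewrite eq_le; apply/andP; split.
  apply: le_ereal_inf_tmp => _ [V V0 <-].
  apply: (@le_trans _ _ (ereal_sup [set (f e / (ln (1 / e)%R)%:E)%E |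
      e in V `&` [set e | 0 < e < 1]])).
    by apply: ereal_inf_lbound; exists (V `&` [set e | 0 < e < 1]) => //;
      apply: filterI => //; exact: interval.
  apply: ge_ereal_sup => _ [e [Ve /= e01] <-].
  apply: le_ereal_sup_tmp; exists (g e / (ln (1 / e)%R)%:E)%E; first by exists e.
  apply: lee_wpmul2r; first by rewrite inve_ge0 lee_fin ltW// ln0.
  by apply: fg; case/andP: e01.
apply: le_ereal_inf_tmp => _ [V [d /= d0 dV] <-]; set l := ereal_sup _.
set u := limf_esup _ _.
have ul (c' c : R) : (l < c'%:E)%E -> c' < c -> (u <= c%:E)%E.
  move=> lc' c'c; pose M := c' * ln 3 / (c - c').
  pose d' := Num.min (Num.min 1 (3 * d)) (expR (- M)).
  have d'0 : 0 < d' by rewrite !lt_min ltr01 mulr_gt0//= expR_gt0.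
  apply: (@le_trans _ _ (ereal_sup [set (g e / (ln (1 / e)%R)%:E)%E |
      e in [set e | 0 < e < d']])).
    by apply: ereal_inf_lbound; exists [set e | 0 < e < d'] => //; exact: interval.
  apply: ge_ereal_sup => _ [e /= + <-].
  rewrite !lt_min => /andP[e0 /andP[/andP[e1 ed] eM]].
  have L0 : 0 < ln (1 / e) by rewrite ln0// e0.
  have e30 : 0 < e / 3 by rewrite divr_gt0.
  have L30 : 0 < ln (1 / (e / 3)) by rewrite ln0// e30/=; lra.
  have Ve : V (e / 3).
    by apply: dV => //=; rewrite sub0r normrN gtr0_norm//; lra.
  have fe : (f (e / 3)%R <= (c' * ln (1 / (e / 3)))%:E)%E.
    rewrite EFinM -ediv//; apply: le_trans (ltW lc').
    by apply: ereal_sup_ubound; exists (e / 3).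
  rewrite ediv//; apply: le_trans (gf e e0) _; apply: le_trans fe _.
  rewrite -EFinM lee_fin.
  have -> : ln (1 / (e / 3)) = ln (1 / e) + ln 3.
    by rewrite -lnM ?posrE ?divr_gt0//; congr ln; field; rewrite gt_eqF.
  have ML : M <= ln (1 / e).
    rewrite div1r lnV ?posrE// lerNr -[leRHS]expRK ler_ln ?posrE ?expR_gt0//.
    exact: ltW.
  have cc : 0 < c - c' by rewrite subr_gt0.
  move: ML; rewrite ler_pdivrMr//; lra.
move: ul; case: l => [r| |] ul; rewrite ?leey//.
  apply/lee_addgt0Pr => e e0; rewrite -EFinD.
  by apply: (ul (r + e / 2)); rewrite ?lte_fin; lra.
case: u ul => [r| |]// ul.
  have := ul (r - 2) (r - 1) (ltNyr _); rewrite lee_fin lerBrDr gerDl ler10.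
  by apply; rewrite ltrD2l ltrN2 ltr1n.
by have := ul 0 1; rewrite ltNyr ltr01 => /(_ isT isT).
Unshelve. all: by end_near. Qed.

Unset Implicit Arguments.

Theorem theorem1p2 (R : realType) (X : pointedMetricType R) (T : X -> X)
    (K : set X) (compactX : compact [set: X]) (contT : continuous T)
    (K_neq0 : K !=set0) (compactK : compact K) :
  mdimFKP T K =
  limf_esup (fun eps : R =>
    (ereal_sup [set entropyFK T mu eps |
                mu in [set mu : probability (borel X) R | mu K = 1]]
     / (ln (1 / eps))%:E)%E) 0^'+.
Proof.
apply: limf_esup_div_ln => e e0; first exact: FKpack_crit_le_sup_entropy.
exact: sup_entropy_le_FKpack_crit.
Qed.
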